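(* Every $M\in\operatorname{SL}(n,\mathbb{R})$ can be written uniquely as $M=NAK$ with $N\in\operatorname{SL}(n,\mathbb{R})$ unit upper triangular, $A\in\operatorname{SL}(n,\mathbb{R})$ diagonal with positive entries, and $K\in\operatorname{SO}(n)$. Moreover, let $V_1,\dots,V_n$ be the row vectors of $M$ and parametrize $$N_{ij}=\begin{cases}1,&i=j\\ x_{ij},&i<j\\ 0,&i>j\end{cases},\qquad A_{ij}=\frac{y_i}{y_{i-1}}\delta_{ij},\quad y_0\equiv y_n\equiv 1,$$ with $y_1,\dots,y_{n-1}>0$. Then $$x_{\mu\nu}=y_{\nu-1}^2\,\epsilon\big(V_\mu,V_{\nu+1},\dots,V_n;\,V_\nu,V_{\nu+1},\dots,V_n\big)\quad(\mu<\nu),$$ $$y_\mu^{-2}=\epsilon\big(V_{\mu+1},\dots,V_n;\,V_{\mu+1},\dots,V_n\big).$$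
   Context: For vectors $A_1,\dots,A_m,B_1,\dots,B_m\in\mathbb{R}^n$, $$\epsilon(A_1,\dots,A_m;B_1,\dots,B_m)=\sum_{a_1,\dots,a_m,i_1,\dots,i_m=1}^n\delta^{i_1\cdots i_m}_{a_1\cdots a_m}(A_1)^{a_1}\cdots(A_m)^{a_m}(B_1)_{i_1}\cdots(B_m)_{i_m},$$ where $\delta^{i_1\cdots i_m}_{a_1\cdots a_m}=m!\,\delta^{i_1}_{[a_1}\cdots\delta^{i_m}_{a_m]}=\frac{1}{(n-m)!}\epsilon_{a_1\cdots a_m\alpha_{m+1}\cdots\alpha_n}\epsilon^{i_1\cdots i_m\alpha_{m+1}\cdots\alpha_n}$ is the generalized Kronecker delta (equivalently $\epsilon(A;B)=\det(A_r\cdot B_s)_{r,s=1}^m$); for $m=0$ the empty product $\epsilon(\,;\,)$ equals $1$. Vector components are in the standard basis. *)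

(* Defs.v *)
From HB Require Import structures.
From mathcomp Require Import all_boot all_order all_fingroup all_algebra.
From mathcomp Require Import reals.

Set Implicit Arguments.
Unset Strict Implicit.
Unset Printing Implicit Defensive.

Import Order.TTheory GRing.Theory Num.Theory.
Local Open Scope ring_scope.

Section GeneralizedDelta.
Variables (R : realType) (n : nat).

(* m! delta^{i_1}_{[a_1} ... delta^{i_m}_{a_m]}: the factor m! cancels the
   normalization 1/m! of the antisymmetrization over the lower indices. *)
Definition gen_delta (m : nat) (i a : {ffun 'I_m -> 'I_n}) : R :=
  \sum_(s : 'S_m) (-1) ^+ s * \prod_(k < m) (i k == a (s k))%:R.

Definition epsilon (m : nat) (A B : m.-tuple 'rV[R]_n) : R :=
  \sum_(a : {ffun 'I_m -> 'I_n}) \sum_(i : {ffun 'I_m -> 'I_n})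
    gen_delta i a * (\prod_(k < m) (tnth A k) 0 (a k))
                  * (\prod_(k < m) (tnth B k) 0 (i k)).

(* The last n - k rows, i.e. V_{k+1}, ..., V_n when the rows of M are numbered
   from 1 as V_1, ..., V_n. *)
Definition rows_after (M : 'M[R]_n) (k : nat) : (n - k).-tuple 'rV[R]_n :=
  [tuple of drop k [tuple row i M | i < n]].

End GeneralizedDelta.

Section Iwasawa.
Variables (R : realType) (n : nat).
Implicit Types M N A K : 'M[R]_n.

Definition in_SL M : Prop := \det M = 1.

Definition in_SO K : Prop := K *m K^T = 1%:M /\ \det K = 1.

Definition unit_upper_triangular N : Prop :=
  (forall i, N i i = 1) /\ (forall i j : 'I_n, (j < i)%N -> N i j = 0).

Definition positive_diagonal A : Prop :=
  is_diag_mx A /\ (forall i, 0 < A i i).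

Definition is_NAK M N A K : Prop :=
  [/\ M = N *m A *m K,
      in_SL N /\ unit_upper_triangular N,
      in_SL A /\ positive_diagonal A
    & in_SO K].

Definition N_of (x : 'I_n -> 'I_n -> R) : 'M[R]_n :=
  \matrix_(i, j) if i == j then 1 else if (i < j)%N then x i j else 0.

(* y is numbered as y_0, ..., y_n (values beyond n are irrelevant), while rows
   are numbered from 0: row i : 'I_n is the (i+1)-st row, whose diagonal entry
   is y_{i+1} / y_i. *)
Definition A_of (y : nat -> R) : 'M[R]_n :=
  \matrix_(i, j) (y i.+1 / y i * (i == j)%:R).

Definition admissible_y (y : nat -> R) : Prop :=
  [/\ y 0%N = 1, y n = 1 & forall k : nat, (0 < k < n)%N -> 0 < y k].

End Iwasawa.

(* Main.v *)
Require Import Defs.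
From HB Require Import structures.
From mathcomp Require Import all_boot all_order all_fingroup all_algebra.
From mathcomp Require Import reals.

Set Implicit Arguments.
Unset Strict Implicit.
Unset Printing Implicit Defensive.

Import Order.TTheory GRing.Theory Num.Theory.
Local Open Scope ring_scope.

(** [epsilon] is the determinant of a matrix of dot products, hence a minor of
    the Gram matrix [M M^T]. If [M = N A K] with [K] orthogonal, then
    [M M^T = N A^2 N^T]; since [N] is upper triangular, a minor of [M M^T] whose
    columns are the last [m] indices is the product of the corresponding minors
    of [N], [A^2] and [N^T], which is [y_k ^- 2] times a minor of [N] equal to
    [1] or [x mu nu]. These formulas recover [x] and [y] from [M], so they also
    give uniqueness. For existence, factor the positive definite matrix [M M^T]
    as [N D N^T] by induction on the size, and take [A] to be the square root
    of [D] and [K] to be [(N A)^-1 M]. *)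

(** * The generalized Kronecker delta as a Gram determinant *)

(** For fixed [a] and [s], the only index that survives in [gen_delta] is [i = a \o s]; what remains
    is the Leibniz sum with each dot product expanded. *)
Lemma epsilon_det (R : realType) (n m : nat) (A B : m.-tuple 'rV[R]_n) :
  epsilon A B = \det (\matrix_(r, s) (tnth A r *m (tnth B s)^T) 0 0).
Proof.
transitivity (\sum_(s : 'S_m) \sum_(a : {ffun 'I_m -> 'I_n})
   (-1) ^+ s * ((\prod_(k < m) (tnth A k) 0 (a k))
                * (\prod_(k < m) (tnth B k) 0 (a (s k))))).
  rewrite exchange_big; apply: eq_bigr => a _ /=.
  under eq_bigr => i _ do rewrite /gen_delta !mulr_suml.
  rewrite exchange_big; apply: eq_bigr => s _ /=.
  rewrite (bigD1 [ffun k => a (s k)]) //= [X in _ + X]big1 ?addr0.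
    rewrite [X in _ * X * _ * _]big1 ?mulr1 ?mulrA.
      by congr (_ * _); apply: eq_bigr => k _; rewrite ffunE.
    by move=> k _; rewrite ffunE eqxx.
  move=> i /eqP ne_i; have [k ne_ik] : exists k, i k != a (s k).
    apply/existsP; rewrite -negb_forall; apply/negP => /forallP eq_i.
    by apply: ne_i; apply/ffunP => k; rewrite ffunE; apply/eqP.
  by rewrite [X in _ * X * _ * _](bigD1 k) //= (negPf ne_ik) mul0r mulr0 !mul0r.
(* The Leibniz sum is read at the inverse permutation, which has the same sign, because [s] acts
   above on the indices of [B] rather than on its vectors. *)
rewrite /determinant (reindex_inj invg_inj) /=; apply: eq_bigr => s _.
rewrite odd_permV -mulr_sumr; congr (_ * _).
under [RHS]eq_bigr => i _ do rewrite !mxE.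
rewrite bigA_distr_bigA /=; apply: eq_bigr => a _.
rewrite [X in _ * X](reindex_inj (@perm_inj _ s)) /= -big_split /=.
by apply: eq_bigr => k _; rewrite permK !mxE.
Qed.

(** * Unit upper triangular matrices and their coordinates *)

Section UnitUpperTriangular.
Variable (R : realType).

Lemma unit_upper_triangular_det (n : nat) (N : 'M[R]_n) :
  unit_upper_triangular N -> \det N = 1.
Proof.
move=> [N1 N0]; rewrite -det_tr det_trig.
  by rewrite big1 // => i _; rewrite mxE N1.
by apply/is_trig_mxP => i j lt_ij; rewrite mxE N0.
Qed.

Lemma N_of_unit_upper_triangular (n : nat) (x : 'I_n -> 'I_n -> R) :
  unit_upper_triangular (N_of x).
Proof.
split=> [i | i j lt_ji]; rewrite mxE ?eqxx //.
by rewrite -(inj_eq val_inj) gtn_eqF // ltnNge ltnW.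
Qed.

Lemma unit_upper_triangular_N_of (n : nat) (N : 'M[R]_n) :
  unit_upper_triangular N -> N = N_of (fun i j => N i j).
Proof.
move=> [N1 N0]; apply/matrixP => i j; rewrite mxE.
case: eqP => [<- | /eqP ne_ij]; first by rewrite N1.
by case: ltnP => // le_ji; rewrite N0 // ltn_neqAle le_ji eq_sym andbT.
Qed.

End UnitUpperTriangular.

(** * Minors of a product [N D N^T] *)

Section Minors.
Variables (R : realType) (n : nat).

(** Since the rows of [N] selected by [c] vanish outside the columns selected by [c], the submatrix
    is itself a product of three square matrices, and no Cauchy-Binet sum appears. *)
Lemma det_mxsub_UDU (m : nat) (N : 'M[R]_n) (d : 'rV[R]_n) (f c : 'I_m -> 'I_n) :
    injective c -> (forall i k, k \notin codom c -> N (c i) k = 0) ->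
  \det (mxsub f c (N *m diag_mx d *m N^T)) =
    \det (mxsub f c N) * (\prod_i d 0 (c i)) * \det (mxsub c c N).
Proof.
move=> c_inj Nc0.
have ->: mxsub f c (N *m diag_mx d *m N^T) =
    mxsub f c N *m diag_mx (\row_i d 0 (c i)) *m (mxsub c c N)^T.
  apply/matrixP => i j; rewrite mul_mx_diag [LHS]mxE mul_mx_diag !mxE.
  rewrite (bigID (mem (c @: [set: 'I_m]))) /= [X in _ + X]big1 ?addr0.
    rewrite big_imset /=; last by move=> ? ? _ _; apply: c_inj.
    by apply: eq_big => k; rewrite ?inE // !mxE.
  move=> k k_c; rewrite !mxE Nc0 ?mulr0 //.
  apply: contra k_c => /codomP [l ->]; exact: imset_f.
rewrite !det_mulmx det_diag det_tr; congr (_ * _ * _).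
by apply: eq_bigr => i _; rewrite mxE.
Qed.

(** The equation is an argument so that the length of the tail can be written either as a difference
    or as a successor. *)
Definition tail_ord (k m : nat) (def_n : (k + m)%N = n) (i : 'I_m) : 'I_n :=
  cast_ord def_n (rshift k i).

Lemma unit_upper_triangular_tail (k m : nat) (def_n : (k + m)%N = n)
    (N : 'M[R]_n) :
  unit_upper_triangular N ->
  unit_upper_triangular (mxsub (tail_ord def_n) (tail_ord def_n) N).
Proof.
move=> [N1 N0].
by split=> [i | i j lt_ji]; rewrite mxE ?N1 // N0 //= ltn_add2l.
Qed.

Lemma det_mxsub_tail (k m : nat) (def_n : (k + m)%N = n)
    (N : 'M[R]_n) (d : 'rV[R]_n) (f : 'I_m -> 'I_n) :
    unit_upper_triangular N ->
  \det (mxsub f (tail_ord def_n) (N *m diag_mx d *m N^T)) =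
    \det (mxsub f (tail_ord def_n) N) * (\prod_i d 0 (tail_ord def_n i)).
Proof.
move=> N_uut; have [_ N0] := N_uut; rewrite det_mxsub_UDU.
- by rewrite (unit_upper_triangular_det (unit_upper_triangular_tail _ N_uut)) mulr1.
- by move=> i j /(congr1 val) /= /addnI /val_inj.
move=> i j j_c; apply: N0 => /=; rewrite (leq_trans _ (leq_addr _ _)) // ltnNge.
apply: contra j_c => le_kj; apply/codomP.
have lt_jm : (j - k < m)%N by rewrite ltn_subLR // def_n.
by exists (Ordinal lt_jm); apply: val_inj; rewrite /= subnKC.
Qed.

End Minors.

(** * The formulas for [x] and [y] *)

Section Formulas.
Variables (R : realType) (n : nat).
Implicit Types (M N A K : 'M[R]_n) (x : 'I_n -> 'I_n -> R) (y : nat -> R).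

Lemma admissible_y_gt0 y k : admissible_y n y -> (k <= n)%N -> 0 < y k.
Proof.
move=> [y0 yn y_gt0] le_kn; have [-> | k_gt0] := posnP k; first by rewrite y0.
move: le_kn; rewrite leq_eqVlt => /predU1P [-> | lt_kn]; first by rewrite yn.
by rewrite y_gt0 ?k_gt0.
Qed.

Lemma prod_ratio (f : nat -> R) m :
  (forall j, (j <= m)%N -> f j != 0) -> \prod_(i < m) (f i.+1 / f i) = f m / f 0%N.
Proof.
elim: m => [|m IHm] f_neq0; first by rewrite big_ord0 divff ?f_neq0.
rewrite big_ord_recr IHm /= => [|j le_jm]; last by rewrite f_neq0 // leqW.
by rewrite mulrC mulrA divfK // f_neq0.
Qed.

(** Common source of both formulas: [f] is left free so that the first row of the tail can be
    exchanged for another one. *)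
Lemma epsilon_rows_tail M K x y (k m : nat) (def_n : (k + m)%N = n)
    (f : 'I_m -> 'I_n) (A B : m.-tuple 'rV[R]_n) :
    M = N_of x *m A_of n y *m K -> K *m K^T = 1%:M -> admissible_y n y ->
    (forall i, tnth A i = row (f i) M) ->
    (forall i, tnth B i = row (tail_ord def_n i) M) ->
  epsilon A B = \det (mxsub f (tail_ord def_n) (N_of x)) * y k ^- 2.
Proof.
move=> def_M KKt y_adm rowA rowB; pose d := \row_(i < n) (y i.+1 / y i).
have def_A : A_of n y = diag_mx d.
  by apply/matrixP => i j; rewrite !mxE mulr_natr.
pose d2 := \row_(i < n) (y i.+1 / y i) ^+ 2.
have def_G : M *m M^T = N_of x *m diag_mx d2 *m (N_of x)^T.
  rewrite def_M !trmx_mul !mulmxA -[_ *m K *m K^T]mulmxA KKt mulmx1.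
  rewrite def_A tr_diag_mx -[_ *m diag_mx d *m diag_mx d]mulmxA mulmx_diag.
  by congr (_ *m diag_mx _ *m _); apply/rowP => i; rewrite !mxE expr2.
rewrite epsilon_det.
have ->: \matrix_(r, s) (tnth A r *m (tnth B s)^T) 0 0
         = mxsub f (tail_ord def_n) (M *m M^T).
  apply/matrixP => r s; rewrite mxE rowA rowB !mxE.
  by apply: eq_bigr => j _; rewrite !mxE.
rewrite def_G det_mxsub_tail; last exact: N_of_unit_upper_triangular.
congr (_ * _).
(* The squared diagonal entries telescope from [k] to [n], where [y n = 1]. *)
transitivity (\prod_(i < m) (y (k + i.+1)%N ^+ 2 / y (k + i)%N ^+ 2)).
  by apply: eq_bigr => i _; rewrite mxE /= addnS expr_div_n.
rewrite (prod_ratio (f := fun i => y (k + i)%N ^+ 2)) => [|j le_jm].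
  by case: y_adm => _ yn _; rewrite def_n yn addn0 expr1n mul1r.
by rewrite expf_neq0 // gt_eqF // (admissible_y_gt0 y_adm) // -def_n leq_add2l.
Qed.

Lemma tnth_rows_after M k (i : 'I_(n - k)) (j : 'I_n) :
  j = (k + i)%N :> nat -> tnth (rows_after M k) i = row j M.
Proof.
move=> def_j; rewrite (tnth_nth 0) /= nth_drop -def_j.
by rewrite -[RHS](tnth_mktuple (fun i => row i M)) (tnth_nth 0).
Qed.

Lemma epsilon_rows_after M K x y mu :
    M = N_of x *m A_of n y *m K -> K *m K^T = 1%:M -> admissible_y n y ->
  (mu <= n)%N -> y mu ^- 2 = epsilon (rows_after M mu) (rows_after M mu).
Proof.
move=> def_M KKt y_adm le_mu; have def_n := subnKC le_mu.
rewrite (epsilon_rows_tail (f := tail_ord def_n) (def_n := def_n) def_M KKt y_adm);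
  try by move=> i; apply: tnth_rows_after.
rewrite unit_upper_triangular_det ?mul1r //.
exact/unit_upper_triangular_tail/N_of_unit_upper_triangular.
Qed.

(** Replacing row [nu] by row [mu] in the tail minor of [N_of x] keeps it upper triangular, with
    [x mu nu] in the corner and ones on the rest of the diagonal. *)
Lemma epsilon_row_rows_after M K x y (mu nu : 'I_n) :
    M = N_of x *m A_of n y *m K -> K *m K^T = 1%:M -> admissible_y n y ->
    (mu < nu)%N ->
  x mu nu = y nu ^+ 2 * epsilon [tuple of row mu M :: rows_after M nu.+1]
                                [tuple of row nu M :: rows_after M nu.+1].
Proof.
move=> def_M KKt y_adm lt_mu_nu.
(* The tail starts at [nu] itself; its length is a successor, to match the tuples with a row
   prepended. *)
have def_n : (nu + (n - nu.+1).+1)%N = n by rewrite addnS -addSn subnKC.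
pose f i := if i == ord0 then mu else tail_ord def_n i.
rewrite (epsilon_rows_tail (f := f) (def_n := def_n) def_M KKt y_adm).
- have y_gt0 := admissible_y_gt0 y_adm (ltnW (ltn_ord nu)).
  rewrite mulrC mulfVK ?expf_neq0 ?gt_eqF //.
  have [N1 N0] := N_of_unit_upper_triangular x.
  rewrite -det_tr det_trig.
    rewrite big_ord_recl big1 ?mulr1 => [|i _]; last by rewrite !mxE /f eqxx.
    have nu_eq : tail_ord def_n ord0 = nu by apply: val_inj; rewrite /= addn0.
    by rewrite 2!mxE /f eqxx nu_eq mxE lt_mu_nu -(inj_eq val_inj) ltn_eqF.
  apply/is_trig_mxP => i j lt_ij; rewrite 2!mxE /f.
  case: eqP => [j0 | _]; first by rewrite j0 in lt_ij.
  by rewrite N0 //= ltn_add2l.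
- move=> i; rewrite /f; case: (unliftP ord0 i) => [j ->|->]; last first.
    by rewrite eqxx tnth0.
  rewrite tnthS; apply: tnth_rows_after => /=.
  by rewrite /bump addnS addSn.
move=> i; case: (unliftP ord0 i) => [j ->|->]; last first.
  by rewrite tnth0; congr row; apply: val_inj; rewrite /= addn0.
rewrite tnthS; apply: tnth_rows_after => /=.
by rewrite /bump addnS addSn.
Qed.

Lemma positive_diagonal_A_of A :
    in_SL A -> positive_diagonal A ->
  exists2 y, admissible_y n y & A = A_of n y.
Proof.
move=> A_SL [/is_diag_mxP A0 A_gt0].
(* The ratios of leading principal minors are the diagonal entries, and [y n] is [\det A]. *)
pose y k := \prod_(i < n | (i < k)%N) A i i.
have y_gt0 k : 0 < y k by apply: prodr_gt0.
exists y; first split=> //.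
- by rewrite /y big_pred0.
- rewrite -A_SL det_trig.
    by apply: eq_bigl => i; rewrite ltn_ord.
  by apply/is_trig_mxP => i j lt_ij; rewrite A0 // ltn_eqF.
apply/matrixP => i j; rewrite mxE; case: eqP => [<- | /eqP ne_ij]; last first.
  by rewrite A0 ?mulr0.
rewrite mulr1 [X in X / _](_ : _ = A i i * y i) ?mulfK ?gt_eqF //.
rewrite /y (bigD1 i) //=; congr (_ * _); apply: eq_bigl => j'.
by rewrite ltnS -(inj_eq val_inj) andbC -ltn_neqAle.
Qed.

End Formulas.

(** * Existence, by factoring a positive definite matrix *)

Section Existence.
Variable R : realType.

Definition posdef (n : nat) (G : 'M[R]_n) : Prop :=
  G^T = G /\ forall v : 'rV_n, v != 0 -> 0 < (v *m G *m v^T) 0 0.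

(** The quadratic form at [v] is the squared norm of [v *m M]. *)
Lemma posdef_gram (n : nat) (M : 'M[R]_n) : M \in unitmx -> posdef (M *m M^T).
Proof.
move=> M_unit; split=> [|v v_neq0]; first by rewrite trmx_mul trmxK.
rewrite mulmxA -[_ *m M^T *m _]mulmxA -trmx_mul mxE; set w := v *m M.
have sq i : w 0 i * w^T i 0 = w 0 i ^+ 2 by rewrite [w^T _ _]mxE.
under eq_bigr => i _ do rewrite sq.
rewrite lt_def sumr_ge0 ?andbT => [|i _]; last exact: sqr_ge0.
apply: contra v_neq0; rewrite psumr_eq0 => [/allP w0|i _]; last exact: sqr_ge0.
rewrite -[v](mulmxK M_unit) -/w (_ : w = 0) ?mul0mx //.
apply/rowP => i; have := w0 i; rewrite mem_index_enum => /(_ isT) /=.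
by rewrite sqrf_eq0 => /eqP ->; rewrite mxE.
Qed.

(** The first row and column are peeled off: induction factors the remaining block, [u] solves the
    equation for the off-diagonal block, and the Schur complement [e] becomes the new diagonal
    entry. *)
Lemma posdef_UDU (n : nat) (G : 'M[R]_n) :
    posdef G ->
  exists N : 'M[R]_n, exists d : 'rV[R]_n,
    [/\ unit_upper_triangular N, forall i, 0 < d 0 i
      & G = N *m diag_mx d *m N^T].
Proof.
elim: n G => [|n IHn] G [G_sym G_pos].
  exists 1%:M, 0; split=> [|[]//|]; last by apply/matrixP => -[].
  by split=> -[].
move: G G_sym G_pos; rewrite -[n.+1]/(1 + n)%N => G.
rewrite -[G]submxK; move: (ulsubmx G) (ursubmx G) (dlsubmx G) (drsubmx G).
move=> a b b' G' {G}; rewrite tr_block_mx => /eq_block_mx [_ _ def_b' G'_sym] G_pos.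
have [|N [d [N_uut d_gt0 def_G']]] := IHn G'.
  (* Vectors with first entry zero see only the block [G']. *)
  split=> // v v_neq0; have := G_pos (row_mx 0 v).
  rewrite mul_row_block !mul0mx !add0r tr_row_mx mul_row_col trmx0 mulmx0 add0r.
  by apply; apply: contra v_neq0 => /eqP; rewrite -row_mx0 => /eq_row_mx [_ ->].
have N_unit : N \in unitmx by rewrite unitmxE unit_upper_triangular_det ?unitr1.
have D_unit : diag_mx d \in unitmx.
  rewrite unitmxE det_diag unitfE gt_eqF //; exact: prodr_gt0.
have [u def_b] : exists u, u *m diag_mx d *m N^T = b.
  exists (b *m invmx N^T *m invmx (diag_mx d)).
  by rewrite !mulmxKV ?unitmx_tr.
pose e := a - u *m diag_mx d *m u^T.
pose N1 : 'M_(1 + n) := block_mx 1%:M u 0 N.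
pose d1 : 'rV_(1 + n) := row_mx e d.
have def_G : block_mx a b b' G' = N1 *m diag_mx d1 *m N1^T.
  rewrite /N1 /d1 diag_mx_row tr_block_mx !mulmx_block.
  rewrite !trmx0 !trmx1 !(mulmx0, mul0mx, addr0, add0r, mul1mx, mulmx1).
  rewrite def_b -def_G' -def_b' -def_b !trmx_mul trmxK tr_diag_mx mulmxA.
  congr block_mx; have ->: diag_mx e = e.
    by apply/matrixP => i j; rewrite mxE !ord1.
  by rewrite addrNK.
have N1_uut : unit_upper_triangular N1.
  have [Nd N0] := N_uut; split=> [i | i j].
    rewrite /N1; case: (split_ordP i) => k ->.
      by rewrite block_mxEul !ord1 mxE.
    by rewrite block_mxEdr.
  rewrite /N1; case: (split_ordP i) => k ->; case: (split_ordP j) => l -> //=.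
  - by rewrite !ord1.
  - by rewrite ord1.
  - by rewrite block_mxEdl mxE.
  by rewrite ltn_add2l block_mxEdr => /N0.
exists N1, d1; split=> // i; rewrite /d1; case: (split_ordP i) => k ->.
  (* e is the value of the quadratic form at the first row of N1^-1. *)
  have N1_unit : N1 \in unitmx by rewrite unitmxE unit_upper_triangular_det ?unitr1.
  pose v : 'rV_(1 + n) := row_mx 1%:M 0 *m invmx N1.
  have v_neq0 : v != 0.
    apply/eqP => /(congr1 (mulmx^~ N1)); rewrite mulmxKV // mul0mx.
    move/(congr1 lsubmx); rewrite row_mxKl => /matrixP/(_ 0 0)/eqP.
    by rewrite !mxE oner_eq0.
  have := G_pos v v_neq0; rewrite def_G !mulmxA mulmxKV //.
  rewrite -mulmxA -trmx_mul mulmxKV // /d1 diag_mx_row mul_row_block.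
  rewrite tr_row_mx mul_row_col !(mulmx0, mul0mx, addr0, trmx0, trmx1, mul1mx, mulmx1).
  by rewrite !ord1 row_mxEl !mxE eqxx mulr1n.
by rewrite row_mxEr.
Qed.

Lemma NAK_exists (n : nat) (M : 'M[R]_n) :
  in_SL M -> exists N A K, is_NAK M N A K.
Proof.
move=> M_SL; have M_unit : M \in unitmx by rewrite unitmxE M_SL unitr1.
have [N [d [N_uut d_gt0 def_G]]] := posdef_UDU (posdef_gram M_unit).
have detN := unit_upper_triangular_det N_uut.
pose a := \row_i Num.sqrt (d 0 i); pose A := diag_mx a.
have a_gt0 i : 0 < a 0 i by rewrite mxE sqrtr_gt0.
have detA_gt0 : 0 < \det A by rewrite det_diag prodr_gt0.
have sqA : A *m A = diag_mx d.
  rewrite mulmx_diag; congr diag_mx; apply/rowP => i.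
  by rewrite !mxE -expr2 sqr_sqrtr // ltW.
(* Determinants in [def_G] give [\det A ^+ 2 = 1], and positivity selects the root. *)
have detA : \det A = 1.
  have /(congr1 determinant) := def_G; rewrite -sqA !det_mulmx !det_tr M_SL detN.
  rewrite mulr1 mul1r mulr1 -expr2 => /esym/eqP.
  by rewrite sqrp_eq1 ?ltW // => /eqP.
have NA_unit : N *m A \in unitmx by rewrite unitmxE det_mulmx detN detA mulr1 unitr1.
exists N, A, (invmx (N *m A) *m M); split.
- by rewrite mulKVmx.
- by split.
- by split=> //; split=> [|i]; [apply: diag_mx_is_diag | rewrite mxE eqxx mulr1n].
split; last by rewrite det_mulmx det_inv det_mulmx detN detA M_SL !mulr1 invr1.
have {}def_G : M *m M^T = N *m A *m (N *m A)^T.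
  by rewrite def_G -sqA [(N *m A)^T]trmx_mul tr_diag_mx !mulmxA.
rewrite trmx_mul mulmxA -[_ *m M *m M^T]mulmxA def_G mulKmx //.
by rewrite -trmx_mul mulVmx ?trmx1.
Qed.

End Existence.

(* Indices mu, nu : 'I_n are 0-based, so y_{nu-1} of the 1-based formula is
   y nu, and V_{nu+1}, ..., V_n is rows_after M nu.+1. *)
Theorem mainTheorem8 (R : realType) (n : nat) (n_gt0 : (0 < n)%N)
    (M : 'M[R]_n) (M_SL : in_SL M) :
  (exists! NAK : 'M[R]_n * 'M[R]_n * 'M[R]_n,
     is_NAK M NAK.1.1 NAK.1.2 NAK.2) /\
  (forall N A K : 'M[R]_n, is_NAK M N A K ->
     (exists (x : 'I_n -> 'I_n -> R) (y : nat -> R),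
        [/\ admissible_y n y, N = N_of x & A = A_of n y]) /\
     (forall (x : 'I_n -> 'I_n -> R) (y : nat -> R),
        admissible_y n y -> N = N_of x -> A = A_of n y ->
        (forall mu nu : 'I_n, (mu < nu)%N ->
           x mu nu = y nu ^+ 2 *
             epsilon [tuple of row mu M :: rows_after M nu.+1]
                     [tuple of row nu M :: rows_after M nu.+1]) /\
        (forall mu : nat, (mu <= n)%N ->
           y mu ^- 2 = epsilon (rows_after M mu) (rows_after M mu)))).
Proof.
have params N A K : is_NAK M N A K ->
    exists x, exists y, [/\ admissible_y n y, N = N_of x & A = A_of n y].
  move=> [_ [_ N_uut] [A_SL A_diag] _].
  have [y y_adm def_A] := positive_diagonal_A_of A_SL A_diag.
  by exists (fun i j => N i j), y; split=> //; apply: unit_upper_triangular_N_of.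
split; last first.
  move=> N A K NAK; split; first exact: params NAK.
  move=> x y y_adm def_N def_A; case: NAK; rewrite def_N def_A => def_M _ _ [KKt _].
  split=> [mu nu|mu]; first exact: epsilon_row_rows_after def_M KKt y_adm.
  exact: epsilon_rows_after def_M KKt y_adm.
have [N [A [K NAK]]] := NAK_exists M_SL.
exists (N, A, K); split=> //= -[[N' A'] K'] /= NAK'.
(* Both decompositions are put in coordinates, which the formulas express through [M] alone. *)
have [x [y [y_adm def_N def_A]]] := params _ _ _ NAK.
have [x' [y' [y'_adm def_N' def_A']]] := params _ _ _ NAK'.
case: NAK NAK' => [def_M [detN _] [detA _] [KKt _]] [def_M' _ _ [KKt' _]].
have def_Mx := def_M; rewrite def_N def_A in def_Mx.
have def_Mx' := def_M'; rewrite def_N' def_A' in def_Mx'.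
(* The formula fixes only [y k ^- 2]; positivity then fixes [y k]. This comes first because the
   formula for [x] contains [y]. *)
have eq_y k : (k <= n)%N -> y k = y' k.
  move=> le_kn; apply/eqP; rewrite -(eqrXn2 (n := 2)) ?ltW //;
    try exact: admissible_y_gt0 le_kn.
  apply/eqP/invr_inj; rewrite (epsilon_rows_after def_Mx KKt y_adm) //.
  by rewrite (epsilon_rows_after def_Mx' KKt' y'_adm).
have eq_N : N = N'.
  rewrite def_N def_N'; apply/matrixP => i j; rewrite !mxE.
  case: ifP => // _; case: ifP => // lt_ij.
  rewrite (epsilon_row_rows_after def_Mx KKt y_adm) //.
  by rewrite (epsilon_row_rows_after def_Mx' KKt' y'_adm) // eq_y // ltnW.
have eq_A : A = A'.
  rewrite def_A def_A'; apply/matrixP => i j; rewrite !mxE !eq_y //; exact: ltnW.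
have NA_unit : N *m A \in unitmx by rewrite unitmxE det_mulmx detN detA mulr1 unitr1.
(* Once [N] and [A] agree, [K] is forced to be [(N A)^-1 M]. *)
rewrite -eq_N -eq_A in def_M' *; congr (_, _, _).
by rewrite -[K](mulKmx NA_unit) -def_M def_M' mulKmx.
Qed.
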